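(* Suppose that the maximal block Jacobi operator $J$ is self-adjoint and that $J$ satisfies nonsubordinacy for some $\lambda\in\mathbb{R}$. Then $\dim \mathrm{GEV}_{\ell^2}(\lambda)=0$ and $\lambda\in\sigma(J)\setminus\sigma_{p}(J)$.
   Context: Let $d\in\mathbb{N}$, $\mathbb{N}_0=\{0,1,2,\dots\}$, and let $(A_n)_{n\ge0},(B_n)_{n\ge 0}$ be sequences in $M_d(\mathbb{C})$ with $\det A_n\ne0$ and $B_n=B_n^*$ for all $n\ge0$; put $A_{-1}:=-I$. $M_d(\mathbb{C})$ carries the operator norm. The formal block Jacobi operator acts on all sequences $u=(u_n)_{n\ge0}$ in $\mathbb{C}^d$ by $(\mathcal{J}u)_0=B_0u_0+A_0u_1$, $(\mathcal{J}u)_n=A_{n-1}^*u_{n-1}+B_nu_n+A_nu_{n+1}$ for $n\ge1$. The maximal block Jacobi operator $J$ in the Hilbert space $\ell^2(\mathbb{N}_0,\mathbb{C}^d)$ is the restriction of $\mathcal{J}$ to $\mathrm{Dom}(J)=\{u\in\ell^2(\mathbb{N}_0,\mathbb{C}^d):\mathcal{J}u\in\ell^2(\mathbb{N}_0,\mathbb{C}^d)\}$. $\sigma(J)$ is its spectrum and $\sigma_p(J)$ its set of eigenvalues. For $\lambda\in\mathbb{C}$, $\mathrm{GEV}_{\ell^2}(\lambda)$ is the linear space of all $u\in\ell^2(\mathbb{N}_0,\mathbb{C}^d)$ satisfying $A_{n-1}^*u_{n-1}+B_nu_n+A_nu_{n+1}=\lambda u_n$ for all $n\ge1$. $\mathrm{MGEV}_{-1}(\lambda)$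 is the space of all sequences $U=(U_n)_{n\ge-1}$ in $M_d(\mathbb{C})$ satisfying $A_{n-1}^*U_{n-1}+B_nU_n+A_nU_{n+1}=\lambda U_n$ for all $n\ge0$. For a sequence $X$ in a normed space and $t\ge0$, with $\{t\}=t-\lfloor t\rfloor$, $$\|X\|_{[0,t]}:=\Big(\sum_{k=0}^{\lfloor t\rfloor}\|X_k\|^2+\{t\}\,\|X_{\lfloor t\rfloor+1}\|^2\Big)^{1/2}.$$ $J$ satisfies nonsubordinacy for $\lambda\in\mathbb{R}$ iff for each pair of non-zero $U,V\in\mathrm{MGEV}_{-1}(\lambda)$ one has $\liminf_{t\to+\infty}\frac{\|U\|_{[0,t]}}{\|V\|_{[0,t]}}<+\infty$ (the quotient is considered for $t>0$, where the denominator is positive). *)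

(* Defs.v *)
From HB Require Import structures.
From mathcomp Require Import all_boot all_order all_algebra.
From mathcomp Require Import complex.
From mathcomp Require Import all_classical all_reals all_analysis.

Set Implicit Arguments.
Unset Strict Implicit.
Unset Printing Implicit Defensive.

Import Order.TTheory GRing.Theory Num.Theory.
Import numFieldNormedType.Exports.

Local Open Scope classical_set_scope.
Local Open Scope ring_scope.
Local Open Scope complex_scope.
Local Open Scope sesquilinear_scope.

Section Dimension.
Context {K : fieldType} {V : lmodType K}.

Definition has_dim (S : set V) (n : nat) : Prop :=
  exists e : 'I_n -> V,
    (forall c : 'I_n -> K, \sum_i c i *: e i = 0 -> forall i, c i = 0) /\
    (forall x, S x <-> exists c : 'I_n -> K, x = \sum_i c i *: e i).

End Dimension.

Section Norms.
Context {R : realType}.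

(* `|z| of the library is R[i]-valued; normc is the R-valued modulus *)
Definition cvnorm {d} (x : 'cV[R[i]]_d) : R :=
  Num.sqrt (\sum_i ComplexField.Normc.normc (x i 0) ^+ 2).

Definition opnorm {d} (M : 'M[R[i]]_d) : R :=
  sup [set cvnorm (M *m x) | x in [set x | cvnorm x <= 1]].

Definition trunc_norm {T : Type} (nrm : T -> R) (X : nat -> T) (t : R) : R :=
  let m := Num.truncn t in
  Num.sqrt (\sum_(0 <= k < m.+1) nrm (X k) ^+ 2
            + (t - m%:R) * nrm (X m.+1) ^+ 2).

End Norms.

Section SequenceSpace.
Context {R : realType} {d : nat}.
Local Notation C := R[i].
Local Notation vseq := (nat -> 'cV[C]_d).

Definition ell2 : set vseq :=
  [set u | cvgn (series (fun n => cvnorm (u n) ^+ 2))].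

Definition ell2_norm (u : vseq) : R :=
  Num.sqrt (limn (series (fun n => cvnorm (u n) ^+ 2))).

Definition cvdot (x y : 'cV[C]_d) : C := \sum_i x i 0 * (y i 0)^*.

(* The complex series is summed componentwise; it converges absolutely for
   u and v in ell2. *)
Definition ell2_dot (u v : vseq) : C :=
  limn (series (fun n => complex.Re (cvdot (u n) (v n))))
  +i* limn (series (fun n => complex.Im (cvdot (u n) (v n)))).

(* An unbounded operator in ell2 is a pair of a domain D and a map T whose
   values are only relevant on D. *)

Definition dense_ell2 (D : set vseq) : Prop :=
  D `<=` ell2 /\
  forall f, ell2 f -> forall e : R, 0 < e ->
    exists2 u, D u & ell2_norm (f - u) < e.

Definition adjoint_graph (D : set vseq) (T : vseq -> vseq) (v w : vseq) : Prop :=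
  [/\ ell2 v, ell2 w & forall u, D u -> ell2_dot (T u) v = ell2_dot u w].

Definition self_adjoint (D : set vseq) (T : vseq -> vseq) : Prop :=
  dense_ell2 D /\
  forall v w, adjoint_graph D T v w <-> D v /\ w = T v.

Definition resolvent_set (D : set vseq) (T : vseq -> vseq) : set C :=
  [set z | set_bij D ell2 (fun u => T u - z *: u) /\
           exists c : R, forall u, D u ->
             ell2_norm u <= c * ell2_norm (T u - z *: u)].

Definition spectrum (D : set vseq) (T : vseq -> vseq) : set C :=
  ~` resolvent_set D T.

Definition point_spectrum (D : set vseq) (T : vseq -> vseq) : set C :=
  [set z | exists u, [/\ D u, u <> 0 & T u = z *: u]].

End SequenceSpace.

Section BlockJacobi.
Context {R : realType} {d : nat}.
Local Notation C := R[i].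
Variables A B : nat -> 'M[C]_d.

Definition jacobi (u : nat -> 'cV[C]_d) (n : nat) : 'cV[C]_d :=
  match n with
  | 0 => B 0%N *m u 0%N + A 0%N *m u 1%N
  | m.+1 => (A m)^t* *m u m + B m.+1 *m u m.+1 + A m.+1 *m u m.+2
  end.

Definition jacobi_dom : set (nat -> 'cV[C]_d) :=
  [set u | ell2 u /\ ell2 (jacobi u)].

Definition GEV_ell2 (lambda : C) : set (nat -> 'cV[C]_d) :=
  [set u | ell2 u /\
    forall n, (A n)^t* *m u n + B n.+1 *m u n.+1 + A n.+1 *m u n.+2
              = lambda *: u n.+1].

(* A_(n-1), with the convention A_(-1) = -I *)
Definition A_pred (n : nat) : 'M[C]_d :=
  match n with 0 => - 1%:M | m.+1 => A m end.

(* A sequence (U_n) indexed by n >= -1 is stored with the index shifted: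
   U k stands for U_(k-1). *)
Definition MGEV (lambda : C) : set (nat -> 'M[C]_d) :=
  [set U | forall n,
    (A_pred n)^t* *m U n + B n *m U n.+1 + A n *m U n.+2 = lambda *: U n.+1].

(* The shift drops U_(-1), which does not enter the truncated norm. *)
Definition mgev_norm (U : nat -> 'M[C]_d) (t : R) : R :=
  trunc_norm opnorm (fun n => U n.+1) t.

Definition nonsubordinacy (lambda : R) : Prop :=
  forall U V : nat -> 'M[C]_d,
    MGEV lambda%:C U -> MGEV lambda%:C V -> U <> 0 -> V <> 0 ->
    (limf_einf (fun t : R => (mgev_norm U t / mgev_norm V t)%:E) +oo%R
       < +oo)%E.

End BlockJacobi.

(* Main.v *)
Require Import Defs.
From mathcomp Require Import all_boot all_order all_algebra.
From mathcomp Require Import complex.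
From mathcomp Require Import all_classical all_reals all_analysis.

Import Order.TTheory GRing.Theory Num.Theory.
Import numFieldNormedType.Exports.

Local Open Scope classical_set_scope.
Local Open Scope ring_scope.
Local Open Scope complex_scope.
Local Open Scope sesquilinear_scope.

Import ComplexField.

(** Everything reduces to showing that GEV_ell2 A B lambda is trivial.  An
eigenvector for lambda lies in GEV_ell2, so lambda is then not an eigenvalue.
If lambda were in the resolvent set, the solution u of
(J - lambda) u = e delta_0, for a unit vector e, would satisfy the recurrence
at all indices n >= 1 and hence lie in GEV_ell2; being zero, it could not be
mapped to e delta_0.

Suppose now that u is a non-zero element of GEV_ell2.  Putting u in one column
of a matrix, with zeros in the other columns, gives a non-zero U in MGEV whose
operator norms are square summable (GEV_MGEV, opnorm_mul_delta).  Thus the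
truncated norms of U are bounded, and nonsubordinacy, applied to the quotient
with U in the denominator, makes the non-decreasing truncated norms of any
non-zero V in MGEV bounded along a sequence tending to infinity, hence
bounded: all of MGEV is square summable (square_summable_of_liminf).

Self-adjointness forbids this.  Take the V in MGEV with V_(-1) = i I and
V_0 = I, and its column w = V e.  Then w is square summable, w_0 = e and
J w = lambda w + i e delta_0: w is an eigenvector, for the real eigenvalue
lambda, of J - i P, where P projects onto the entry at index 0, and for a
symmetric J this forces P w = 0.  Indeed, termwise the imaginary part of
<(J w)_n, w_n> is |e|^2 at n = 0 and vanishes afterwards, while that of <w_n, (J w)_n> is
-|e|^2 at n = 0 and vanishes afterwards.  So the symmetry
<J w, w> = <w, J w> yields e = 0 (self_adjoint_no_defect).  Choosing one
vector w instead of a pair means that no boundary term at infinity has to be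
controlled. *)

(** * The Euclidean norm and the operator norm *)

Section Norms.
Context {R : realType}.
Local Notation C := R[i].

Lemma normc_ge0 (z : C) : 0 <= Normc.normc z.
Proof. by case: z => x y; exact: sqrtr_ge0. Qed.

Lemma sqr_cvnorm {d} (x : 'cV[C]_d) :
  cvnorm x ^+ 2 = \sum_i Normc.normc (x i 0) ^+ 2.
Proof. by rewrite sqr_sqrtr // sumr_ge0 // => i _; rewrite sqr_ge0. Qed.

Lemma cvnorm_ge0 {d} (x : 'cV[C]_d) : 0 <= cvnorm x.
Proof. exact: sqrtr_ge0. Qed.

Lemma cvnormZ {d} (c : C) (x : 'cV[C]_d) :
  cvnorm (c *: x) = Normc.normc c * cvnorm x.
Proof.
rewrite /cvnorm -[Normc.normc c in RHS](ger0_norm (normc_ge0 c)) -sqrtr_sqr.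
rewrite -sqrtrM ?sqr_ge0 //.
by congr Num.sqrt; rewrite mulr_sumr; apply: eq_bigr => i _;
  rewrite mxE Normc.normcM exprMn.
Qed.

Lemma normc_le_cvnorm {d} (x : 'cV[C]_d) i : Normc.normc (x i 0) <= cvnorm x.
Proof.
rewrite -(@ler_pXn2r _ 2) ?nnegrE ?normc_ge0 ?cvnorm_ge0 // sqr_cvnorm.
by rewrite (bigD1 i) //= lerDl sumr_ge0 // => j _; rewrite sqr_ge0.
Qed.

Lemma cvnorm0 {d} : cvnorm (0 : 'cV[C]_d) = 0.
Proof.
by rewrite /cvnorm big1 ?sqrtr0 // => i _; rewrite mxE Normc.normc0 expr0n.
Qed.

Lemma cvnorm_eq0 {d} (x : 'cV[C]_d) : cvnorm x = 0 -> x = 0.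
Proof.
move=> x0; apply/matrixP => i j; rewrite ord1 mxE; apply: Normc.eq0_normc.
by apply/eqP; rewrite eq_le normc_ge0 andbT -x0 normc_le_cvnorm.
Qed.

Lemma cvnorm_delta {d} (i : 'I_d) : cvnorm (delta_mx i 0 : 'cV[C]_d) = 1.
Proof.
rewrite /cvnorm (bigD1 i) //= big1 => [|j ji].
  by rewrite mxE !eqxx Normc.normc1 expr1n addr0 sqrtr1.
by rewrite mxE (negbTE ji) Normc.normc0 expr0n.
Qed.

Lemma normc_sum {n} (F : 'I_n -> C) :
  Normc.normc (\sum_i F i) <= \sum_i Normc.normc (F i).
Proof.
elim/big_ind2: _ => // [|a b c e ab ce]; first by rewrite Normc.normc0.
by apply: le_trans (lerD ab ce); exact: le_normcD.
Qed.

(** The content is that the supremum defining the operator norm is finite: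
every coordinate of a vector of norm at most 1 has modulus at most 1, so the
l1-norms of the rows of M bound the coordinates of the image. *)
Lemma cvnorm_mulmx_le_opnorm {d} (M : 'M[C]_d) (x : 'cV[C]_d) :
  cvnorm x <= 1 -> cvnorm (M *m x) <= opnorm M.
Proof.
move=> x1; apply: ub_le_sup; last by exists x.
exists (Num.sqrt (\sum_i (\sum_j Normc.normc (M i j)) ^+ 2)) => _ [y /= y1 <-].
rewrite ler_wsqrtr //; apply: ler_sum => i _.
rewrite ler_pXn2r // ?nnegrE ?normc_ge0 ?sumr_ge0 //.
  rewrite mxE; apply: le_trans (normc_sum _) _; apply: ler_sum => j _.
  rewrite Normc.normcM ler_piMr ?normc_ge0 //.
  exact: le_trans (normc_le_cvnorm _ _) y1.
by move=> j _; rewrite normc_ge0.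
Qed.

(** A matrix whose only non-zero column is u maps x to x_i u, and |x_i| <= 1
on the unit ball, with equality at the i-th basis vector.  This is what
transfers square summability from vectors to matrices. *)
Lemma opnorm_mul_delta {d} (u : 'cV[C]_d) (i : 'I_d) :
  opnorm (u *m (delta_mx 0 i : 'rV[C]_d)) = cvnorm u.
Proof.
apply/eqP; rewrite eq_le; apply/andP; split.
  apply: ge_sup.
    by exists (cvnorm (u *m (delta_mx 0 i : 'rV[C]_d) *m 0)), 0 => //=;
      rewrite cvnorm0.
  move=> _ [x /= x1 <-].
  have -> : u *m delta_mx 0 i *m x = x i 0 *: u.
    by rewrite -mulmxA -rowE [row i x]mx11_scalar mul_mx_scalar mxE.
  rewrite cvnormZ ler_piMl ?cvnorm_ge0 //.
  exact: le_trans (normc_le_cvnorm _ _) x1.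
rewrite -[leLHS](_ : cvnorm (u *m delta_mx 0 i *m delta_mx i 0) = _).
  by apply: cvnorm_mulmx_le_opnorm; rewrite cvnorm_delta.
by rewrite -mulmxA mul_delta_mx [delta_mx _ _]mx11_scalar mxE !eqxx mulmx1.
Qed.

End Norms.

(** * Square-summable sequences and truncated norms *)

Section SquareSummable.
Context {R : realType}.

Lemma cvg_series_sqr (a : nat -> R) (M : R) :
  (forall n, \sum_(0 <= k < n) a k ^+ 2 <= M) ->
  cvgn (series (fun n => a n ^+ 2)).
Proof.
move=> aM; apply: nondecreasing_is_cvgn; last first.
  by exists M => _ [n _ <-]; exact: aM.
by apply: nondecreasing_series => n _ _; exact: sqr_ge0.
Qed.

Lemma sum_sqr_le_lim (a : nat -> R) n : cvgn (series (fun n => a n ^+ 2)) ->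
  \sum_(0 <= k < n) a k ^+ 2 <= limn (series (fun n => a n ^+ 2)).
Proof.
move=> ca; apply: (nondecreasing_cvgn_le _ ca n).
by apply: nondecreasing_series => k _ _; exact: sqr_ge0.
Qed.

(** The bound is only asked from index 1 on, because the first entry never
matters for summability; this accommodates both J w, which differs from
lambda w at 0, and a sequence supported at 0 (with u = 0). *)
Lemma ell2_dominated {d} (u v : nat -> 'cV[R[i]]_d) (c : R) :
  ell2 u -> (forall n, cvnorm (v n.+1) <= c * cvnorm (u n.+1)) -> ell2 v.
Proof.
move=> lu vu.
apply: (@cvg_series_sqr _ (cvnorm (v 0%N) ^+ 2 +
  c ^+ 2 * limn (series (fun n => cvnorm (u n) ^+ 2)))).
have l0 := sum_sqr_le_lim _ 0 lu; rewrite big_geq // in l0.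
case=> [|n].
  by rewrite big_geq // addr_ge0 ?(mulr_ge0 (sqr_ge0 c)) ?sqr_ge0.
rewrite big_nat_recl //= lerD2l.
apply: le_trans (ler_wpM2l (sqr_ge0 c) (sum_sqr_le_lim _ n.+1 lu)).
rewrite big_nat_recl //= mulrDr -[leLHS]add0r.
rewrite lerD ?(mulr_ge0 (sqr_ge0 c)) ?sqr_ge0 //.
rewrite mulr_sumr; apply: ler_sum => k _; rewrite -exprMn.
by rewrite ler_pXn2r ?nnegrE ?cvnorm_ge0 // (le_trans _ (vu k)) ?cvnorm_ge0.
Qed.

Lemma sum_sqr_le_trunc_norm (a : nat -> R) (t : R) n : (n%:R <= t) ->
  \sum_(0 <= k < n) a k ^+ 2 <= trunc_norm id a t ^+ 2.
Proof.
move=> nt; have t0 : 0 <= t by apply: le_trans nt.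
have /andP[tt _] := truncn_itv t0.
have r0 : 0 <= (t - (Num.truncn t)%:R) * a (Num.truncn t).+1 ^+ 2.
  by rewrite mulr_ge0 ?sqr_ge0 ?subr_ge0.
have s0 m : 0 <= \sum_(0 <= k < m) a k ^+ 2.
  by apply: sumr_ge0 => k _; exact: sqr_ge0.
rewrite /trunc_norm sqr_sqrtr ?addr_ge0 // -[leLHS]addr0 lerD //.
rewrite [leRHS](@big_cat_nat _ _ _ n) //=; last first.
  by apply: leqW; rewrite truncn_ge_nat.
by rewrite lerDl sumr_ge0 // => k _; exact: sqr_ge0.
Qed.

Lemma trunc_norm_le_sum (a : nat -> R) (t : R) : 0 <= t ->
  trunc_norm id a t <= Num.sqrt (\sum_(0 <= k < (Num.truncn t).+2) a k ^+ 2).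
Proof.
move=> t0; have /andP[tt tt1] := truncn_itv t0.
apply: ler_wsqrtr; rewrite [leRHS]big_nat_recr //= lerD2l ler_piMl ?sqr_ge0 //.
by rewrite lerBlDl natr1 ltW.
Qed.

(** Any real K above the lower limit works: the infimum of f over each half-line
]T, +oo[ is at most the lower limit. *)
Lemma limf_einf_pinfty_lt (f : R -> R) :
  (limf_einf (fun t => (f t)%:E) +oo%R < +oo)%E ->
  exists K, forall T, exists2 t, T < t & f t < K.
Proof.
move=> fin.
have [K fK] : exists K : R, (limf_einf (fun t => (f t)%:E) +oo%R < K%:E)%E.
  case: (limf_einf _ _) fin => [r _|//|_]; last by exists 0; rewrite ltNyr.
  by exists (r + 1); rewrite lte_fin ltrDl.
exists K => T.
have : (ereal_inf [set (f t)%:E | t in [set t | (T < t)%R]] < K%:E)%E.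
  apply: le_lt_trans fK; rewrite limf_einfE; apply: ereal_sup_ubound.
  by exists [set t | (T < t)] => //; exact: nbhs_pinfty_gt (num_real T).
by move=> /ereal_inf_lt[_ [t Tt <-]]; rewrite lte_fin => ?; exists t.
Qed.

(** The core of nonsubordinacy: if a is square summable, its truncated norms
are at most |a|_2, so a bound K on the quotients at arbitrarily large t bounds
the truncated norms of b by K |a|_2 there, hence all its partial sums.  The
non-zero entry of a makes the denominators positive for large t. *)
Lemma square_summable_of_liminf (a b : nat -> R) k :
  cvgn (series (fun n => a n ^+ 2)) -> a k != 0 ->
  (limf_einf (fun t => (trunc_norm id b t / trunc_norm id a t)%:E) +oo%R
     < +oo)%E ->
  cvgn (series (fun n => b n ^+ 2)).
Proof.
move=> ca ak /limf_einf_pinfty_lt[K freq].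
set L := limn (series (fun n => a n ^+ 2)).
apply: (@cvg_series_sqr _ ((K * Num.sqrt L) ^+ 2)) => n.
(* t beyond n makes trunc_norm b t dominate the n-th partial sum; t beyond
   k.+1 makes trunc_norm a t positive. *)
have [t] := freq (maxn n k.+1)%:R; set q := _ / _ => tn qK.
have le_t m : (m <= maxn n k.+1)%N -> m%:R <= t.
  by move=> mn; apply: le_trans (ltW tn); rewrite ler_nat.
have t0 : 0 <= t by exact: le_trans (ler0n _ _) (le_t 0%N isT).
have a_gt0 : 0 < trunc_norm id a t.
  rewrite lt0r sqrtr_ge0 andbT -sqrf_eq0 gt_eqF //.
  apply: lt_le_trans (sum_sqr_le_trunc_norm a t k.+1 (le_t _ (leq_maxr _ _))).
  rewrite big_nat_recr //= ltr_wpDl ?sumr_ge0 ?exprn_even_gt0 //.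
  by move=> j _; rewrite sqr_ge0.
have q_ge0 : 0 <= q by rewrite divr_ge0 ?sqrtr_ge0.
apply: le_trans (sum_sqr_le_trunc_norm b t n (le_t _ (leq_maxl _ _))) _.
have -> : trunc_norm id b t = q * trunc_norm id a t by rewrite divfK ?gt_eqF.
have le_pow (x y : R) : 0 <= x -> x <= y -> x ^+ 2 <= y ^+ 2.
  by move=> x0 xy; rewrite ler_pXn2r // nnegrE // (le_trans x0).
apply: le_pow; first by rewrite mulr_ge0 // ltW.
apply: ler_pM => //; [exact: ltW | exact: ltW |].
apply: le_trans (trunc_norm_le_sum a t t0) _.
by apply: ler_wsqrtr; exact: sum_sqr_le_lim.
Qed.

End SquareSummable.

(** * Imaginary parts of inner products *)

Section InnerProduct.
Context {R : realType} {d : nat}.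
Local Notation C := R[i].

Lemma cvdot_self (x : 'cV[C]_d) : cvdot x x = (cvnorm x ^+ 2)%:C.
Proof.
rewrite sqr_cvnorm rmorph_sum; apply: eq_bigr => i _.
by rewrite -sqr_normc rmorphXn.
Qed.

Lemma Im_cvdotZl (z : C) (x : 'cV[C]_d) :
  complex.Im (cvdot (z *: x) x) = complex.Im z * cvnorm x ^+ 2.
Proof.
have -> : cvdot (z *: x) x = z * cvdot x x.
  by rewrite mulr_sumr; apply: eq_bigr => i _; rewrite mxE mulrA.
by rewrite cvdot_self; case: z => a b /=; rewrite mulr0 add0r.
Qed.

Lemma Im_cvdotZr (z : C) (x : 'cV[C]_d) :
  complex.Im (cvdot x (z *: x)) = - (complex.Im z * cvnorm x ^+ 2).
Proof.
have -> : cvdot x (z *: x) = z^* * cvdot x x.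
  by rewrite mulr_sumr; apply: eq_bigr => i _; rewrite mxE rmorphM mulrCA.
by rewrite cvdot_self; case: z => a b /=; rewrite mulr0 add0r mulNr.
Qed.

Lemma lim_series_single (a : nat -> R) :
  (forall n, a n.+1 = 0) -> limn (series a) = a 0%N.
Proof.
move=> a0; apply/cvg_lim => //; rewrite -cvg_shiftS.
apply: cvg_near_cst; near=> n.
by rewrite /series /= big_nat_recl // big1 ?addr0.
Unshelve. all: end_near. Qed.

End InnerProduct.

(** * Solutions of the block Jacobi recurrence *)

Section BlockJacobi.
Context {R : realType} {d : nat}.
Local Notation C := R[i].
Variables A B : nat -> 'M[C]_d.

Lemma trmxC_A_pred0 : (A_pred A 0)^t* = - 1%:M.
Proof.
apply/matrixP => i j; rewrite !mxE eq_sym.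
by rewrite rmorphN rmorph_nat.
Qed.

(** The pair of consecutive terms (U_(n-1), U_n) of the solution starting with
U_(-1) = X and U_0 = Y; carrying both makes the second-order recurrence
structural. *)
Fixpoint mgev_pair (z : C) (X Y : 'M[C]_d) n : 'M[C]_d * 'M[C]_d :=
  if n is m.+1 then
    let: (P, Q) := mgev_pair z X Y m in
    (Q, invmx (A m) *m (z *: Q - (A_pred A m)^t* *m P - B m *m Q))
  else (X, Y).

Lemma MGEV_initial_values (z : C) (X Y : 'M[C]_d) :
  (forall n, \det (A n) != 0) ->
  exists V, [/\ MGEV A B z V, V 0%N = X & V 1%N = Y].
Proof.
move=> detA; exists (fun n => (mgev_pair z X Y n).1); split=> // n /=.
case: (mgev_pair z X Y n) => P Q /=.
rewrite mulKVmx ?unitmxE ?unitfE //.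
by rewrite -[z *: Q - _ - _]addrA -opprD [LHS]addrC subrK.
Qed.

(** Since A_(-1) = -I, the term U_(-1) of a matrix solution is exactly the
defect (J - z) U at index 0; the columns inherit this. *)
Lemma jacobi_MGEV_column (z : C) V (x : 'cV[C]_d) : MGEV A B z V ->
  let v n := V n.+1 *m x in
  jacobi A B v 0 = z *: v 0%N + V 0%N *m x /\
  forall n, jacobi A B v n.+1 = z *: v n.+1.
Proof.
move=> MV v; split=> [|n].
  have := congr1 (mulmx^~ x) (MV 0%N).
  rewrite trmxC_A_pred0 mulNmx mul1mx !mulmxDl mulNmx -scalemxAl => <-.
  by rewrite -!mulmxA -[- _ + _ + _]addrA [RHS]addrC addNKr.
by have := congr1 (mulmx^~ x) (MV n.+1); rewrite !mulmxDl -scalemxAl -!mulmxA.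
Qed.

(** An element of GEV_ell2 satisfies the recurrence only from n = 1 on; taking
(J u - z u)_0 as the entry at index -1 makes it hold at n = 0 as well.  The
row y spreads the vector solution over the columns of a matrix. *)
Lemma GEV_MGEV (z : C) u (y : 'rV[C]_d) : GEV_ell2 A B z u ->
  MGEV A B z
    (fun n => (if n is m.+1 then u m else jacobi A B u 0 - z *: u 0%N) *m y).
Proof.
case=> _ Gu [|n]; rewrite !mulmxA -!mulmxDl scalemxAl.
  by rewrite trmxC_A_pred0 mulNmx mul1mx opprB -addrA subrK.
by rewrite -Gu.
Qed.

Lemma GEV_ell2_eigen (z : C) u : ell2 u ->
  (forall n, jacobi A B u n.+1 = z *: u n.+1) -> GEV_ell2 A B z u.
Proof. by move=> lu Ju; split=> // n; rewrite -Ju. Qed.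

End BlockJacobi.

(** * Nonsubordinacy against self-adjointness *)

Section GEVTrivial.
Context {R : realType} {d : nat}.
Local Notation C := R[i].
Variables A B : nat -> 'M[C]_d.

Lemma ell2_mulmx_column (V : nat -> 'M[C]_d) (x : 'cV[C]_d) :
  cvgn (series (fun n => opnorm (V n) ^+ 2)) -> cvnorm x <= 1 ->
  ell2 (fun n => V n *m x).
Proof.
move=> cV x1.
apply: (@cvg_series_sqr _ _ (limn (series (fun n => opnorm (V n) ^+ 2)))) => n.
apply: le_trans (sum_sqr_le_lim _ n cV); apply: ler_sum => k _.
have := cvnorm_mulmx_le_opnorm (V k) x x1 => Vx.
by rewrite ler_pXn2r // nnegrE ?(le_trans _ Vx) ?cvnorm_ge0.
Qed.

(** Both inner-product series have imaginary parts supported at n = 0, where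
they equal |w_0|^2 and -|w_0|^2; symmetry identifies them. *)
Lemma self_adjoint_no_defect (lambda : R) (w : nat -> 'cV[C]_d) :
  self_adjoint (jacobi_dom A B) (jacobi A B) -> ell2 w ->
  jacobi A B w 0 = (lambda%:C + 'i) *: w 0%N ->
  (forall n, jacobi A B w n.+1 = lambda%:C *: w n.+1) ->
  w 0%N = 0.
Proof.
move=> [_ saJ] lw Jw0 JwS.
have lJw : ell2 (jacobi A B w).
  apply: (ell2_dominated w _ (Normc.normc lambda%:C)) => // n.
  by rewrite JwS cvnormZ.
have [_ _ /(_ w (conj lw lJw))] :=
  (saJ w (jacobi A B w)).2 (conj (conj lw lJw) erefl).
move=> /(congr1 (@complex.Im R)) /=; rewrite !lim_series_single; first last.
- by move=> n; rewrite JwS Im_cvdotZl mul0r.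
- by move=> n; rewrite JwS Im_cvdotZr mul0r oppr0.
rewrite Jw0 Im_cvdotZl Im_cvdotZr /= add0r mul1r => /eqP.
rewrite -addr_eq0 -mulr2n mulrn_eq0 /= sqrf_eq0 => /eqP.
exact: cvnorm_eq0.
Qed.

(** One non-zero element of GEV_ell2 would be the denominator that makes every
solution square summable, in particular the one with initial values
V_(-1) = i I, V_0 = I, whose columns have the forbidden defect i w_0. *)
Lemma GEV_ell2_trivial (lambda : R) (u : nat -> 'cV[C]_d) : (0 < d)%N ->
  (forall n, \det (A n) != 0) ->
  self_adjoint (jacobi_dom A B) (jacobi A B) ->
  nonsubordinacy A B lambda ->
  GEV_ell2 A B lambda%:C u -> u = 0.
Proof.
move=> d_gt0 detA saJ nonsub Gu; apply: contrapT => u_neq0.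
have [k uk] : exists k, cvnorm (u k) != 0.
  apply: contrapT => /forallNP u0; apply: u_neq0; apply/funext => k.
  by apply: cvnorm_eq0; apply/eqP; apply: contrapT => /negP; exact: u0.
pose i0 := Ordinal d_gt0.
pose e := delta_mx i0 0 : 'cV[C]_d.
have e_neq0 : e <> 0.
  by move=> e0; have /eqP := cvnorm_delta (R := R) i0;
    rewrite -/e e0 cvnorm0 eq_sym oner_eq0.
have MU := GEV_MGEV A B _ _ (delta_mx 0 i0) Gu.
set U := (X in MGEV _ _ _ X) in MU.
have opU n : opnorm (U n.+1) = cvnorm (u n) by exact: opnorm_mul_delta.
have U_neq0 : U <> 0.
  move=> U0; move: uk; rewrite -opU.
  have -> : U k.+1 = (0 : 'cV[C]_d) *m (delta_mx 0 i0 : 'rV[C]_d).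
    by rewrite U0 mul0mx.
  by rewrite opnorm_mul_delta cvnorm0 eqxx.
have [V [MV V0 V1]] :=
  MGEV_initial_values A B lambda%:C ('i *: 1%:M) 1%:M detA.
have V_neq0 : V <> 0.
  by move=> VE; apply: e_neq0; rewrite -(mul1mx e) -V1 VE; exact: mul0mx.
have cV : cvgn (series (fun n => opnorm (V n.+1) ^+ 2)).
  apply: (square_summable_of_liminf (fun n => opnorm (U n.+1)) _ k).
  - by under eq_fun do rewrite opU; exact: Gu.1.
  - by rewrite opU.
  - exact: nonsub MV MU V_neq0 U_neq0.
have [J0 JS] := jacobi_MGEV_column A B _ _ e MV.
apply: e_neq0; rewrite -(mul1mx e) -V1.
apply: (self_adjoint_no_defect lambda (fun n => V n.+1 *m e)) => //.
- by apply: (ell2_mulmx_column (fun n => V n.+1)); rewrite ?cvnorm_delta.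
- by rewrite J0 V0 V1 mul1mx -scalemxAl mul1mx scalerDl.
Qed.

End GEVTrivial.

Theorem theorem6p5 (R : realType) (d : nat) (d_gt0 : (0 < d)%N)
    (A B : nat -> 'M[R[i]]_d)
    (detA : forall n, \det (A n) != 0)
    (hermB : forall n, B n = (B n)^t*)
    (saJ : self_adjoint (jacobi_dom A B) (jacobi A B))
    (lambda : R) (nonsub : nonsubordinacy A B lambda) :
  has_dim (GEV_ell2 A B lambda%:C) 0 /\
  (spectrum (jacobi_dom A B) (jacobi A B)
     `\` point_spectrum (jacobi_dom A B) (jacobi A B)) lambda%:C.
Proof.
have GEV0 u : GEV_ell2 A B lambda%:C u -> u = 0.
  exact: GEV_ell2_trivial.
have ell2_0 : ell2 (0 : nat -> 'cV[R[i]]_d).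
  apply: (@cvg_series_sqr _ _ 0) => n; rewrite big1 // => k _.
  by rewrite cvnorm0 expr0n.
split; last split.
- exists (fun=> 0); split=> [c _ [] //|u]; split=> [/GEV0 ->|[c ->]].
    by exists (fun=> 0); rewrite big_ord0.
  by rewrite big_ord0; split=> // n; rewrite !mulmx0 scaler0 !addr0.
- move=> [[_ _ surj] _].
  pose e := delta_mx (Ordinal d_gt0) 0 : 'cV[R[i]]_d.
  (* the preimage of f under J - lambda would lie in GEV_ell2 *)
  pose f n : 'cV[R[i]]_d := if n is 0 then e else 0.
  have lf : ell2 f.
    by apply: (ell2_dominated 0 f 0) => // n; rewrite cvnorm0 mul0r.
  have [u [lu _] Ju] := surj f lf.
  have u0 : u = 0.
    apply: GEV0; apply: GEV_ell2_eigen => // n; apply/eqP.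
    by rewrite -subr_eq0; apply/eqP; have := congr1 (fun g => g n.+1) Ju.
  have e0 : e = 0.
    have := congr1 (fun g => g 0%N) Ju; rewrite u0 /= => <-.
    by rewrite /= scaler0 subr0 /= !mulmx0 addr0.
  have /eqP := cvnorm_delta (R := R) (Ordinal d_gt0).
  by rewrite -/e e0 cvnorm0 eq_sym oner_eq0.
- case=> u [[lu _] u_neq0 Ju]; apply: u_neq0; apply: GEV0.
  by apply: GEV_ell2_eigen => // n; rewrite Ju.
Qed.
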